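(* If $( *G, \sim)$ then $( *G, <) \mapsto (\mathbb{R}/\overline{\mathbb{R}}, =)$. That is: if $f, g \in *G$ satisfy $f \sim g$ and $f < g$ in $*G$, then after transfer to $\overline{\mathbb{R}}$ the relation becomes equality, i.e. the realizations of $f$ and $g$ in $\overline{\mathbb{R}}$ are equal.
   Context: $*G$ denotes the gossamer number system: numbers built from the finite integers together with infinite integers (integers larger in magnitude than every finite integer) in the same way that the reals are built from the integers. It is taken to be a totally ordered field containing the ordered field $\mathbb{R}$ as a subfield and containing infinite numbers. A number in $*G$ is a positive (negative) infinity if it is larger (smaller) than every real number; $\Phi^{-1}$ is the set of all infinities, and $\Phi = \{x \in *G\setminus\{0\}: 1/x \in \Phi^{-1}\}$ is the set of infinitesimals. $a \simeq b$ means $a - b \in \Phi \cup \{0\}$; $f \sim g$ means $g\neq 0$ and $f/g \simeq 1$. $\overline{\mathbb{R}} = \mathbb{R} \cup \{\pm\infty\}$. The transfer $*G \mapsto \mathbb{R}/\overline{\mathbb{R}}$ realizes infinitesimals as $0$ and infinities as $\pm\infty$: the realization of a positive (negative) infinity is $+\infty$ ($-\infty$), and the realization of any other element $a$ is its standard part, the unique real $r$ with $a \simeq r$. *)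

(* Defs.v *)
From HB Require Import structures.
From mathcomp Require Import all_boot all_order all_algebra.
From mathcomp Require Import boolp classical_sets reals constructive_ereal.

Set Implicit Arguments.
Unset Strict Implicit.
Unset Printing Implicit Defensive.

Import Order.TTheory GRing.Theory Num.Theory.

Local Open Scope classical_set_scope.
Local Open Scope ring_scope.

(* [*G] is given by a totally ordered field [G] together with an embedding
   [iota] of the ordered field [R] of real numbers; the requirements on
   [iota] are those of [gossamer] below. *)

Definition positive_infinity (R : realType) (G : realFieldType)
    (iota : R -> G) : set G :=
  [set x | forall r : R, iota r < x].

Definition negative_infinity (R : realType) (G : realFieldType)
    (iota : R -> G) : set G :=
  [set x | forall r : R, x < iota r].

(* $\Phi^{-1}$ *)
Definition infinities (R : realType) (G : realFieldType)
    (iota : R -> G) : set G :=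
  positive_infinity iota `|` negative_infinity iota.

(* $\Phi$; note that 0 is excluded. *)
Definition infinitesimals (R : realType) (G : realFieldType)
    (iota : R -> G) : set G :=
  [set x | x != 0 /\ infinities iota (1 / x)].

Definition gossamer (R : realType) (G : realFieldType)
    (iota : {rmorphism R -> G}) : Prop :=
  {mono iota : x y / x <= y} /\ infinities iota !=set0.

(* $a \simeq b$ *)
Definition infinitely_close (R : realType) (G : realFieldType)
    (iota : R -> G) (a b : G) : Prop :=
  (infinitesimals iota `|` [set 0]) (a - b).

(* $f \sim g$ *)
Definition asymptotic (R : realType) (G : realFieldType)
    (iota : R -> G) (f g : G) : Prop :=
  g != 0 /\ infinitely_close iota (f / g) 1.

(* The default value 0 of [xget] is never used on elements that are not
   infinities: see [standard_part_ex] and [standard_part_uniq]. *)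
Definition standard_part (R : realType) (G : realFieldType)
    (iota : R -> G) (a : G) : R :=
  xget 0 [set r : R | infinitely_close iota a (iota r)].

Definition realization (R : realType) (G : realFieldType)
    (iota : R -> G) (a : G) : \bar R :=
  if `[< positive_infinity iota a >] then +oo%E
  else if `[< negative_infinity iota a >] then -oo%E
  else (standard_part iota a)%:E.

Lemma infinitely_closeP (R : realType) (G : realFieldType)
    (iota : {rmorphism R -> G}) (iota_mono : {mono iota : x y / x <= y})
    (a b : G) :
  infinitely_close iota a b <->
  (forall e : R, 0 < e -> `|a - b| < iota e).
Proof.
have iota_lt := leW_mono iota_mono.
have iota_gt0 e : 0 < e -> 0 < iota e by rewrite -(iota_lt 0) rmorph0.
set x := a - b; rewrite /infinitely_close -/x; split.
  case=> [[x0 xinf] e e0|/= ->]; last by rewrite normr0; exact: iota_gt0.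
  have {xinf}: iota e^-1 < `|x|^-1.
    rewrite -normfV; case: xinf => /= xinf.
      by have := xinf e^-1; rewrite mul1r => /lt_le_trans; apply; exact: ler_norm.
    have := xinf (- e^-1); rewrite mul1r rmorphN ltrNr => /lt_le_trans; apply.
    by rewrite -normrN ler_norm.
  by rewrite fmorphV ltf_pV2 // posrE ?normr_gt0// iota_gt0.
move=> xsmall; have [->|x0] := eqVneq x 0; [by right|left; split => //=].
rewrite mul1r.
have big (r : R) : iota r < `|x|^-1.
  have r1 : 0 < Num.max r 1 by rewrite lt_max ltr01 orbT.
  apply: (@le_lt_trans _ _ (iota (Num.max r 1))).
    by rewrite iota_mono le_max lexx.
  rewrite -[iota _]invrK ltf_pV2 ?posrE ?invr_gt0 ?normr_gt0 ?iota_gt0//.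
  by rewrite -fmorphV xsmall// invr_gt0.
have [xge0|xlt0] := leP 0 x.
  by left => r; have := big r; rewrite ger0_norm.
right => r; have := big (- r).
by rewrite ltr0_norm// invrN rmorphN ltrN2.
Qed.

Lemma standard_part_ex (R : realType) (G : realFieldType)
    (iota : {rmorphism R -> G}) (iota_mono : {mono iota : x y / x <= y})
    (a : G) :
  ~ infinities iota a -> exists r : R, infinitely_close iota a (iota r).
Proof.
have iota_lt := leW_mono iota_mono.
move=> /not_orP[/existsNP[u /negP] + /existsNP[l /negP]].
rewrite -!leNgt => au la.
pose S : set R := [set r | iota r <= a].
have supS : has_sup S.
  split; first by exists l.
  by exists u => r /= ra; rewrite -iota_mono (le_trans ra).
exists (sup S); apply/(infinitely_closeP iota_mono) => e e0.
rewrite ltr_norml; apply/andP; split.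
  rewrite ltrBrDr addrC -rmorphB.
  have [s Ss] := sup_adherent e0 supS.
  by rewrite -iota_lt => /lt_le_trans; apply.
rewrite ltrBlDr -rmorphD ltNge; apply/negP => h.
have : S (e + sup S) by [].
by move/(ub_le_sup supS.2); rewrite gerDr leNgt e0.
Qed.

Lemma standard_part_uniq (R : realType) (G : realFieldType)
    (iota : {rmorphism R -> G}) (iota_mono : {mono iota : x y / x <= y})
    (a : G) (r s : R) :
  infinitely_close iota a (iota r) -> infinitely_close iota a (iota s) ->
  r = s.
Proof.
have iota_lt := leW_mono iota_mono.
move=> /(infinitely_closeP iota_mono) ar /(infinitely_closeP iota_mono) as_.
apply/eqP/negPn/negP => rs.
have e0 : 0 < `|r - s| / 2 by rewrite divr_gt0// normr_gt0 subr_eq0.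
have := ltrD (ar _ e0) (as_ _ e0); rewrite -rmorphD -splitr distrC.
move=> /(le_lt_trans (ler_normD _ _)).
rewrite addrA subrK -rmorphB.
case: (leP 0 (r - s)) => h; first by rewrite (ger0_norm h) => /(le_lt_trans (ler_norm _)); rewrite ltxx.
by rewrite (ltr0_norm h) rmorphN -normrN => /(le_lt_trans (ler_norm _)); rewrite ltxx.
Qed.

(* Main.v *)
(* If f ~ g then |f - g| < e |g| for every real e > 0. With e = 1/2 this puts
   f strictly between g/2 and 3g/2, so f is a positive (negative) infinity iff
   g is. If g is bounded by a real M, taking e/M instead of e gives f ≃ g, and
   ≃-equivalent elements have the same standard part. *)
Require Import Defs.
From mathcomp Require Import all_boot all_order all_algebra.
From mathcomp Require Import boolp classical_sets reals constructive_ereal.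
From mathcomp Require Import lra.

Set Implicit Arguments.
Unset Strict Implicit.
Unset Printing Implicit Defensive.

Import Order.TTheory GRing.Theory Num.Theory.

Local Open Scope ring_scope.

(** Closeness of [f / g] to 1 reads [|f / g - 1| < iota e]; multiplying by [|g| > 0] clears the
    denominator. *)
Lemma asymptotic_dist (R : realType) (G : realFieldType)
    (iota : {rmorphism R -> G}) (iota_mono : {mono iota : x y / x <= y})
    (f g : G) :
  asymptotic iota f g -> forall e : R, 0 < e -> `|f - g| < iota e * `|g|.
Proof.
move=> [g0 /(infinitely_closeP iota_mono) fg1] e /fg1.
rewrite -(ltr_pM2r (x := `|g|)) ?normr_gt0//.
by rewrite -normrM mulrBl mul1r divfK.
Qed.

Lemma asymptoticN (R : realType) (G : realFieldType)
    (iota : R -> G) (f g : G) :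
  asymptotic iota f g -> asymptotic iota (- f) (- g).
Proof. by move=> [g0 fg]; split; rewrite ?oppr_eq0// invrN mulrNN. Qed.

Lemma negative_infinityN (R : realType) (G : realFieldType)
    (iota : {rmorphism R -> G}) (x : G) :
  negative_infinity iota x <-> positive_infinity iota (- x).
Proof.
split=> xinf r; first by rewrite ltrNr -rmorphN; exact: xinf.
by rewrite -ltrN2 -rmorphN; exact: xinf.
Qed.

Lemma asymptotic_positive_infinity (R : realType) (G : realFieldType)
    (iota : {rmorphism R -> G}) (iota_mono : {mono iota : x y / x <= y})
    (f g : G) :
  asymptotic iota f g -> positive_infinity iota f <-> positive_infinity iota g.
Proof.
move=> fg.
have half_gt0 : 0 < 2^-1 :> R by rewrite invr_gt0 ltr0n.
have := asymptotic_dist iota_mono fg half_gt0.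
rewrite fmorphV rmorph_nat ltr_norml => /andP[lo hi].
split=> inf r.
  (* Here [f - g < |g| / 2]. If [g < 0], then [f < g / 2 < 0], against [0 < f]. Otherwise
     [2 * r < f < 3 * g / 2] gives [r < g] for [r >= 0], and [r < 0 <= g] settles the other sign. *)
  have := inf 0; have := inf (2 * r); have := inf r.
  rewrite rmorphM rmorph_nat rmorph0 => fr f2r f0.
  have [g0|g0] := lerP 0 g; last by rewrite ltr0_norm// in hi; lra.
  by rewrite ger0_norm// in hi; lra.
(* Since [g > 0], the lower bound is [g / 2 < f], so [2 * r < g] suffices for [r < f]. *)
have := inf 0; have := inf (2 * r).
rewrite rmorphM rmorph_nat rmorph0 => g2r g0.
by rewrite gtr0_norm// in lo; lra.
Qed.

(** Negation preserves [~] and exchanges the two kinds of infinity. *)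
Lemma asymptotic_negative_infinity (R : realType) (G : realFieldType)
    (iota : {rmorphism R -> G}) (iota_mono : {mono iota : x y / x <= y})
    (f g : G) :
  asymptotic iota f g -> negative_infinity iota f <-> negative_infinity iota g.
Proof.
move=> /asymptoticN fg; rewrite !negative_infinityN.
exact: asymptotic_positive_infinity.
Qed.

Lemma finite_norm_bound (R : realType) (G : realFieldType)
    (iota : {rmorphism R -> G}) (iota_mono : {mono iota : x y / x <= y})
    (x : G) :
  ~ infinities iota x -> exists2 M : R, 0 < M & `|x| <= iota M.
Proof.
move=> /(standard_part_ex iota_mono)[r /(infinitely_closeP iota_mono) xr].
(* [x] lies within 1 of the real [r]; the added 1 also keeps the bound positive, so that one can
   divide by it later. *)
exists (`|r| + 1); first by rewrite ltr_wpDl.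
have {}xr := xr 1 ltr01; rewrite rmorph1 ltr_norml in xr.
have /andP[rlo rhi] : - iota `|r| <= iota r <= iota `|r|.
  by rewrite -rmorphN !iota_mono -ler_norml.
rewrite ler_norml rmorphD rmorph1.
by case/andP: xr => xlo xhi; apply/andP; split; lra.
Qed.

Lemma asymptotic_infinitely_close (R : realType) (G : realFieldType)
    (iota : {rmorphism R -> G}) (iota_mono : {mono iota : x y / x <= y})
    (f g : G) :
  ~ infinities iota g -> asymptotic iota f g -> infinitely_close iota f g.
Proof.
move=> /(finite_norm_bound iota_mono)[M M0 gM] fg.
apply/(infinitely_closeP iota_mono) => e e0.
have eM0 : 0 < e / M by rewrite divr_gt0.
apply: (lt_le_trans (asymptotic_dist iota_mono fg eM0)).
have -> : iota e = iota (e / M) * iota M by rewrite -rmorphM divfK ?gt_eqF.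
by rewrite ler_wpM2l// -(rmorph0 iota) iota_mono ltW.
Qed.

Lemma infinitely_close_sym (R : realType) (G : realFieldType)
    (iota : {rmorphism R -> G}) (iota_mono : {mono iota : x y / x <= y})
    (a b : G) :
  infinitely_close iota a b -> infinitely_close iota b a.
Proof.
move=> /(infinitely_closeP iota_mono) ab.
by apply/(infinitely_closeP iota_mono) => e; rewrite distrC; exact: ab.
Qed.

Lemma infinitely_close_trans (R : realType) (G : realFieldType)
    (iota : {rmorphism R -> G}) (iota_mono : {mono iota : x y / x <= y})
    (a b c : G) :
  infinitely_close iota a b -> infinitely_close iota b c ->
  infinitely_close iota a c.
Proof.
move=> /(infinitely_closeP iota_mono) ab /(infinitely_closeP iota_mono) bc.
apply/(infinitely_closeP iota_mono) => e e0.
have e20 : 0 < e / 2 by rewrite divr_gt0.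
apply: (le_lt_trans (ler_distD b a c)).
by rewrite [e]splitr rmorphD ltrD ?ab ?bc.
Qed.

(** The sets of reals infinitely close to [a] and to [b] coincide, so [xget] picks the same element
    from both, or the default 0 if they are empty. *)
Lemma infinitely_close_standard_part (R : realType) (G : realFieldType)
    (iota : {rmorphism R -> G}) (iota_mono : {mono iota : x y / x <= y})
    (a b : G) :
  infinitely_close iota a b -> standard_part iota a = standard_part iota b.
Proof.
move=> ab; rewrite /standard_part; congr (xget 0 _).
apply/seteqP; split=> r /=; apply: infinitely_close_trans => //.
exact: infinitely_close_sym.
Qed.

Theorem theorem4p3 (R : realType) (G : realFieldType)
    (iota : {rmorphism R -> G}) (iotaG : gossamer iota)
    (f g : G) (fg_sim : asymptotic iota f g) (fg_lt : f < g) :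
  realization iota f = realization iota g.
Proof.
have [iota_mono _] := iotaG.
rewrite /realization.
(* Once the tests on [f] are replaced by those on [g], both sides take the same branch; only the
   finite branch then has content. *)
rewrite (propext (asymptotic_positive_infinity iota_mono fg_sim)).
rewrite (propext (asymptotic_negative_infinity iota_mono fg_sim)).
case: asboolP => // gpos; case: asboolP => // gneg; congr (_%:E).
apply: infinitely_close_standard_part => //.
by apply: asymptotic_infinitely_close => // -[].
Qed.
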